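(* Let $(\varphi,\psi)$ be a pair of kernels such that $M_1(\varphi)+\tilde M_1(\psi)<+\infty$, and let $f\in Lip\,\alpha$ with $0<\alpha\le 1$. Then there exists a constant $C>0$ such that $$\lVert S_w^{\varphi,\psi}f-f\rVert_\infty\le C\,w^{-\alpha}\qquad\text{for every } w>0.$$
   Context: $C(\mathbb{R})$ denotes the space of all uniformly continuous and bounded functions $f:\mathbb{R}\to\mathbb{R}$, $\lVert\cdot\rVert_\infty$ is the sup norm, for $\delta>0$ $$\omega(f,\delta):=\sup\{|f(x)-f(y)|:\ |x-y|<\delta,\ x,y\in\mathbb{R}\},$$ and for $0<\alpha\le1$, $Lip\,\alpha:=\{f\in C(\mathbb{R}):\ \omega(f,\delta)=\mathcal{O}(\delta^\alpha)\text{ as }\delta\to0^+\}$. For $g:\mathbb{R}\to\mathbb{R}$ and $\nu\ge 0$ put $$M_\nu(g):=\sup_{u\in\mathbb{R}}\sum_{k\in\mathbb{Z}}|g(u-k)|\,|u-k|^\nu,\qquad \tilde M_\nu(g):=\int_{\mathbb{R}}|t|^\nu|g(t)|\,dt.$$ A pair of kernels $(\varphi,\psi)$ is a pair of functions $\varphi,\psi:\mathbb{R}\to\mathbb{R}$ in $L^1(\mathbb{R})$ such that: $\varphi$ is bounded in a neighborhood of the origin; $\sum_{k\in\mathbb{Z}}\varphi(u-k)=1$ for every $u\in\mathbb{R}$; $\int_{\mathbb{R}}\psi(u)\,du=1$; and there exists $r>0$ with $M_r(\varphi)<+\infty$. The Durrmeyer sampling operators are, for $w>0$ and any $f$ for which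 the series converges for every $x$, $$(S_w^{\varphi,\psi}f)(x)=\sum_{k\in\mathbb{Z}}\varphi(wx-k)\,w\int_{\mathbb{R}}\psi(wu-k)f(u)\,du,\qquad x\in\mathbb{R}.$$ *)

(* Defs.v *)
From mathcomp Require Import all_boot all_order all_algebra.
From mathcomp Require Import all_classical all_reals all_analysis.

Set Implicit Arguments.
Unset Strict Implicit.
Unset Printing Implicit Defensive.

Import Order.TTheory GRing.Theory Num.Theory.
Import numFieldNormedType.Exports.

Local Open Scope classical_set_scope.
Local Open Scope ring_scope.

(* Integration is with respect to the completed Lebesgue measure: the library's
   lebesgue_measure lives on the Borel sets, so integrability for it would
   demand Borel (not just Lebesgue) measurability. *)
Definition L1 (R : realType) (g : R -> R) : Prop :=
  (@completed_lebesgue_measure R).-integrable setT (fun t => (g t)%:E).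

Definition integralR (R : realType) (g : R -> R) : R :=
  Rintegral (@completed_lebesgue_measure R) setT g.

(* A bilateral series converges when both of its halves (k >= 0 and k < 0) do;
   recall that Negz n is - (n + 1). *)
Definition cvg_bisum (R : realType) (a : int -> R) : Prop :=
  cvgn (series (fun n => a (Posz n))) /\ cvgn (series (fun n => a (Negz n))).

Definition bisum (R : realType) (a : int -> R) : R :=
  limn (series (fun n => a (Posz n))) + limn (series (fun n => a (Negz n))).

Definition modulus (R : realType) (f : R -> R) (delta : R) : R :=
  sup [set z | exists x y : R, `|x - y| < delta /\ z = `|f x - f y|].

Definition CR (R : realType) (f : R -> R) : Prop :=
  unif_continuous f /\ bounded_fun f.

Definition Lip (R : realType) (alpha : R) (f : R -> R) : Prop :=
  CR f /\ modulus f =O_ ((0 : R)^'+) (fun delta : R => delta `^ alpha).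

Definition supnorm (R : realType) (g : R -> R) : \bar R :=
  ereal_sup (range (fun x : R => `|g x|%:E)).

Definition discrete_moment (R : realType) (nu : R) (g : R -> R) : \bar R :=
  ereal_sup (range (fun u : R =>
    \esum_(k in [set: int]) (`|g (u - k%:~R)| * `|u - k%:~R| `^ nu)%:E)).

Definition continuous_moment (R : realType) (nu : R) (g : R -> R) : \bar R :=
  integral (@completed_lebesgue_measure R) setT
    (fun t : R => (`|t| `^ nu * `|g t|)%:E).

Definition kernel_pair (R : realType) (phi psi : R -> R) : Prop :=
  [/\ L1 phi /\ L1 psi,
      bounded_near phi (nbhs (0 : R)),
      forall u : R, cvg_bisum (fun k : int => phi (u - k%:~R)) /\
                    bisum (fun k : int => phi (u - k%:~R)) = 1,
      integralR psi = 1 &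
      exists2 r : R, 0 < r & (discrete_moment r phi < +oo)%E].

Definition durrmeyer_term (R : realType) (phi psi : R -> R) (w : R)
    (f : R -> R) (x : R) (k : int) : R :=
  phi (w * x - k%:~R) * (w * integralR (fun u : R => psi (w * u - k%:~R) * f u)).

Definition durrmeyer (R : realType) (phi psi : R -> R) (w : R)
    (f : R -> R) (x : R) : R :=
  bisum (durrmeyer_term phi psi w f x).

(* Limits and integrals are total in the library, so that durrmeyer is only
   meaningful when this holds. *)
Definition durrmeyer_defined (R : realType) (phi psi : R -> R) (w : R)
    (f : R -> R) : Prop :=
  (forall k : int, L1 (fun u : R => psi (w * u - k%:~R) * f u)) /\
  (forall x : R, cvg_bisum (durrmeyer_term phi psi w f x)).

(* Main.v *)
Require Import Defs.
From mathcomp Require Import all_boot all_order all_algebra.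
From mathcomp Require Import all_classical all_reals all_analysis.
From mathcomp Require Import measurable_realfun ring lra.
Import Order.TTheory GRing.Theory Num.Theory.
Import numFieldNormedType.Exports.
Local Open Scope classical_set_scope.
Local Open Scope ring_scope.

(** The kernel phi is a partition of unity and w * psi (w u - k) has integral 1,
    so the error at x is
      sum_k phi (w x - k) * (w * int psi (w u - k) (f u - f x) du).
    A Lipschitz-class function is globally Hoelder,
      |f u - f x| <= K |u - x|^alpha
    (lemma Lip_hoelder: the hypothesis only speaks of small distances, but f is
    bounded).  Writing w (u - x) = (w u - k) - (w x - k) and using
    r^alpha <= 1 + r, one gets
      |u - x|^alpha <= w^(-alpha) (1 + |w u - k| + |w x - k|),
    and the change of variables t = w u - k bounds the inner factor by
      K w^(-alpha) ((1 + |w x - k|) |psi|_1 + int |t| |psi t| dt)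
    (lemma mean_error_le).  Multiplying by |phi (w x - k)| and summing over k
    leaves the discrete moments of phi of orders 0 and 1, which do not depend
    on x or w.  The moment of order 1 is finite by hypothesis; the one of order
    0 is then finite because phi is bounded near the origin, where the weight
    |t| fails to dominate a constant (lemma discrete_moment0_sum).

    The same estimate, applied to finite partial sums, yields the convergence
    of the bilateral series (lemma bisum_le).

    The change of variables is needed for the completed Lebesgue measure, which
    is the outer measure restricted to its Caratheodory-measurable sets.  It
    therefore suffices to know how the outer measure transforms
    (lemma ext_preimage_affine), and that follows from covers by intervals;
    Borel sets and null sets need not be separated. *)

Set Implicit Arguments.
Unset Strict Implicit.
Unset Printing Implicit Defensive.

(** * Affine changes of variables for the completed Lebesgue measure *)

Notation lebesgue_ext R := ((wlength (@idfun R))^*)%mu.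
Notation lebesgue_type R := (caratheodory_type (lebesgue_ext R)).

Definition affine (R : realType) (w c u : R) : R := w * u - c.

Lemma preimage_affine_ocitv (R : realType) (w c a b : R) : 0 < w ->
  affine w c @^-1` `]a, b] = `]w^-1 * (a + c), w^-1 * (b + c)]%classic.
Proof.
move=> w0; apply/seteqP; split => u /=;
  by rewrite !in_itv/= /affine ltrBrDr lerBlDr ltr_pdivrMl// ler_pdivlMl.
Qed.

Lemma wlength_preimage_affine (R : realType) (w c : R) (X : set R) : 0 < w ->
  ocitv X ->
  ocitv (affine w c @^-1` X) /\
  (wlength idfun (affine w c @^-1` X) = w^-1%:E * wlength idfun X)%E.
Proof.
move=> w0 [[a b] _ <-] /=; rewrite preimage_affine_ocitv//; split.
  exact: is_ocitv.
have w'0 : 0 < w^-1 by rewrite invr_gt0.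
rewrite !wlength_itv /= !lte_fin (ltr_pM2l w'0) ltrD2r.
case: ifP => _; last by rewrite mule0.
by rewrite -!EFinB -EFinM; congr EFin; ring.
Qed.

(** Pulling back a countable cover of X by half-open intervals gives a cover of
    the preimage of X, with every length divided by w. *)
Lemma le_ext_preimage_affine (R : realType) (w c : R) (X : set R) : 0 < w ->
  (w%:E * lebesgue_ext R (affine w c @^-1` X) <= lebesgue_ext R X)%E.
Proof.
move=> w0; apply: le_ereal_inf_tmp => _ [F [mF XF] <-].
have mF' k := wlength_preimage_affine c w0 (mF k).
rewrite -lee_pdivlMl//; apply: ge_ereal_inf.
exists (\sum_(k <oo) wlength idfun (affine w c @^-1` F k))%E.
  exists (fun k => affine w c @^-1` F k) => //; split.
    by move=> k; case: (mF' k).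
  by rewrite -preimage_bigcup; exact: preimage_subset.
rewrite -nneseriesZl; last by move=> k _; exact: wlength_ge0.
by rewrite (eq_eseriesr (fun k _ => (mF' k).2)).
Qed.

Lemma affineVK (R : realType) (w c : R) : w != 0 ->
  cancel (affine w^-1 (- (c / w))) (affine w c).
Proof. by move=> w0 u; rewrite /affine; field. Qed.

Lemma affineK (R : realType) (w c : R) : w != 0 ->
  cancel (affine w c) (affine w^-1 (- (c / w))).
Proof. by move=> w0 u; rewrite /affine; field. Qed.

(** The inequality missing from le_ext_preimage_affine is the same lemma for the
    inverse affine map. *)
Lemma ext_preimage_affine (R : realType) (w c : R) (X : set R) : 0 < w ->
  (w%:E * lebesgue_ext R (affine w c @^-1` X))%E = lebesgue_ext R X.
Proof.
move=> w0; apply/eqP; rewrite eq_le le_ext_preimage_affine//=.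
have w'0 : 0 < w^-1 by rewrite invr_gt0.
have := @le_ext_preimage_affine R w^-1 (- (c / w)) (affine w c @^-1` X) w'0.
rewrite -comp_preimage (_ : _ \o _ = id); last first.
  by apply/funext => u /=; rewrite affineVK ?gt_eqF.
by rewrite preimage_id lee_pdivrMl.
Qed.

(** The map is a bijection, so every test set is itself a preimage, and the
    Caratheodory identity for A is carried over by the scaling of the outer
    measure. *)
Lemma caratheodory_affine (R : realType) (w c : R) (A : set R) : 0 < w ->
  (lebesgue_ext R).-caratheodory A ->
  (lebesgue_ext R).-caratheodory (affine w c @^-1` A).
Proof.
move=> w0 mA X.
pose Y := affine w^-1 (- (c / w)) @^-1` X.
have -> : X = affine w c @^-1` Y.
  rewrite /Y -comp_preimage (_ : _ \o _ = id) ?preimage_id//.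
  by apply/funext => u /=; rewrite affineK ?gt_eqF.
have wK (B : set R) :
    lebesgue_ext R (affine w c @^-1` B) = (w^-1%:E * lebesgue_ext R B)%E.
  by rewrite -(ext_preimage_affine c B w0) muleA -EFinM mulVf ?mul1e ?gt_eqF.
rewrite preimage_setC -!preimage_setI !wK (mA Y).
by rewrite ge0_muleDr//; exact: mu_ext_ge0.
Qed.

Lemma measurable_affine (R : realType) (w c : R) : 0 < w ->
  measurable_fun setT (affine w c : lebesgue_type R -> lebesgue_type R).
Proof. by move=> w0 _ A mA; rewrite setTI; exact: caratheodory_affine. Qed.

(** Integrating after the affine map is integrating against the image measure,
    which is the completed Lebesgue measure divided by w. *)
Lemma ge0_integral_affine (R : realType) (w c : R)
    (g : lebesgue_type R -> \bar R) : 0 < w ->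
  measurable_fun setT g -> (forall t, 0 <= g t)%E ->
  (w%:E * integral (@completed_lebesgue_measure R) setT (g \o affine w c)
   = integral (@completed_lebesgue_measure R) setT g)%E.
Proof.
move=> w0 mg g0.
rewrite -[in LHS](preimage_setT (affine w c)).
rewrite -(@ge0_integral_pushforward _ _ _ _ _ _ (measurable_affine c w0))//.
rewrite -(@ge0_integral_mscale _ _ _ _ _ _ (NngNum (ltW w0)))//.
  exact: measurable_affine.
move=> maff; apply: eq_measure_integral => A _ _.
exact: ext_preimage_affine.
Qed.

Lemma integrable_affine (R : realType) (w c : R) (g : R -> R) : 0 < w ->
  L1 g -> L1 (g \o affine w c).
Proof.
move=> w0 /integrableP[mg ig]; apply/integrableP; split.
  exact: (measurableT_comp mg (measurable_affine c w0)).
have := @ge0_integral_affine R w c (fun t => `|(g t)%:E|%E) w0.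
have mabs := measurableT_comp (@abse_measurable _ _) mg.
move=> /(_ mabs (fun _ => abse_ge0 _)) E.
rewrite ltey; apply/eqP => Ioo; move: E ig.
by rewrite /comp Ioo gt0_muley ?lte_fin// => <-.
Qed.

Lemma integral_affine (R : realType) (w c : R) (g : R -> R) : 0 < w ->
  L1 g -> w * integralR (g \o affine w c) = integralR g.
Proof.
move=> w0 ig; have iga := integrable_affine c w0 ig.
have /integrableP[mg _] := ig.
apply: EFin_inj; rewrite EFinM /integralR /Rintegral.
rewrite !fineK; [|exact: integrable_fin_num..].
rewrite [in RHS]integralE [in LHS]integralE.
rewrite -(ge0_integral_affine c w0 (measurable_funepos mg))//.
rewrite -(ge0_integral_affine c w0 (measurable_funeneg mg))//.
rewrite muleBr//.
  by rewrite -funepos_comp -funeneg_comp.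
by apply: fin_num_adde_defr; exact: integrable_pos_fin_num.
Qed.

(** * Integrability over the completed Lebesgue measure *)

(** Borel measurability suffices: Borel sets satisfy the Caratheodory
    criterion. *)
Lemma measurable_fun_lebesgue (R : realType) (f : R -> R) :
  measurable_fun setT f -> measurable_fun setT (f : lebesgue_type R -> R).
Proof.
move=> mf _ A mA; apply: sub_caratheodory.
exact: mf.
Qed.

Lemma L1_norm (R : realType) (g : R -> R) : L1 g -> L1 (fun t => `|g t|).
Proof. exact: integrable_norm. Qed.

Lemma L1_moment (R : realType) (g : R -> R) : L1 g ->
  (continuous_moment 1 g < +oo)%E -> L1 (fun t => `|t| * `|g t|).
Proof.
move=> /L1_norm/integrableP[mg _] mom; apply/integrableP; split.
  apply/measurable_EFinP; apply: measurable_funM.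
    apply: measurable_fun_lebesgue; exact: normr_measurable.
  exact/measurable_EFinP.
apply: le_lt_trans mom; rewrite le_eqVlt; apply/orP; left; apply/eqP.
apply: eq_integral => t _ /=.
by rewrite powRr1// ger0_norm// mulr_ge0.
Qed.

Lemma unif_continuous_continuous (U V : uniformType) (f : U -> V) :
  unif_continuous f -> continuous f.
Proof.
move=> uf x; apply/cvg_entourageP => E eE.
by apply: filterS (nbhs_entourage x (uf E eE)) => y /xsectionP.
Qed.

Lemma L1_mul (R : realType) (g f : R -> R) : L1 g -> CR f ->
  L1 (fun t => g t * f t).
Proof.
move=> ig [/unif_continuous_continuous cf bf].
have mf : measurable_fun setT (f : lebesgue_type R -> R).
  exact: measurable_fun_lebesgue (continuous_measurable_fun cf).
have := integrableMl measurableT ig mf bf.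
by apply: eq_integrable => // t _; rewrite EFinM.
Qed.

(** * Hoelder continuity *)

Lemma powR_le_1D (R : realType) (alpha r : R) : 0 <= alpha -> alpha <= 1 ->
  0 <= r -> r `^ alpha <= 1 + r.
Proof.
move=> a0 a1 r0; have [r1|r1] := leP r 1.
  have : r `^ alpha <= 1 `^ alpha by apply: ge0_ler_powR; rewrite ?nnegrE.
  by rewrite powR1 => /le_trans; apply; rewrite lerDl.
by apply: ler_wpDl => //; apply: ler1_powR => //; exact: ltW.
Qed.

(** The growth condition gives the bound for points closer than some c; for
    points further apart, |f x - f y| is at most twice the supremum of |f|, and
    |x - y|^alpha is at least c^alpha. *)
Lemma Lip_hoelder (R : realType) (alpha : R) (f : R -> R) : 0 < alpha ->
  Lip alpha f ->
  exists2 K, 0 <= K & forall x y, `|f x - f y| <= K * `|x - y| `^ alpha.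
Proof.
move=> a0 [[_ [B0 [_ fB0]]] fO].
pose B := `|B0| + 1.
have fB x : `|f x| <= B by apply: (fB0 B) => //; rewrite ltr_pwDr// ler_norm.
have dB x y : `|f x - f y| <= B + B.
  by rewrite (le_trans (ler_normB _ _))// lerD.
(* The modulus is a real supremum, which bounds its elements only because the
   set is bounded. *)
have f_mod x y d : `|x - y| < d -> `|f x - f y| <= modulus f d.
  move=> xyd; apply: ub_le_sup; last by exists x, y.
  by exists (B + B) => _ [x' [y' [_ ->]]].
have /eqO_exP[k k0 near_k] := fO.
move: near_k; rewrite near_withinE => /nbhs_ballP[d0 /= d00 fk].
(* Below, the modulus is taken at 2 |x - y|, since it only sees pairs at
   distance strictly less than its argument; 2 |x - y| < 2 c < d0 is then in the
   range of the growth condition. *)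
pose c := d0 / 4; have c0 : 0 < c by rewrite divr_gt0.
have c2 : 2 * c < d0 by rewrite /c; lra.
have B2 : 0 <= B + B by exact: le_trans (dB 0 0).
have K1 : 0 <= k * 2 `^ alpha by rewrite mulr_ge0 ?powR_ge0 ?(ltW k0).
have K2 : 0 <= (B + B) / c `^ alpha by rewrite divr_ge0 ?powR_ge0.
exists (k * 2 `^ alpha + (B + B) / c `^ alpha); first exact: addr_ge0.
move=> x y; have [->|xy] := eqVneq x y.
  by rewrite !subrr normr0 mulr_ge0 ?powR_ge0 ?addr_ge0.
have r0 : 0 < `|x - y| by rewrite normr_gt0 subr_eq0.
rewrite mulrDl; have [rc|cr] := ltP `|x - y| c.
  apply: ler_wpDr; first by rewrite mulr_ge0 ?powR_ge0.
  apply: (le_trans (f_mod x y (2 * `|x - y|) _)); first lra.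
  rewrite -mulrA -powRM ?(ltW r0)//; apply: le_trans (ler_norm _) _.
  have r20 : 0 < 2 * `|x - y| by rewrite mulr_gt0.
  have /fk/(_ r20) : ball 0 d0 (2 * `|x - y|).
    rewrite -ball_normE/= sub0r normrN gtr0_norm//.
    by apply: lt_trans c2; rewrite ltr_pM2l.
  by rewrite (ger0_norm (powR_ge0 _ _)).
apply: ler_wpDl; first by rewrite mulr_ge0 ?powR_ge0.
rewrite (le_trans (dB x y))// -mulrA ler_peMr// ler_pdivlMl ?powR_gt0// mulr1.
by apply: ge0_ler_powR; rewrite ?nnegrE ?(ltW a0) ?(ltW c0) ?(ltW r0).
Qed.

(** * Bilateral series *)

(** Bounding the sums over all finite sets of indices, rather than the two
    halves of the series, keeps the bound M for the whole bilateral sum. *)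
Lemma bisum_le (R : realType) (a : int -> R) (M : R) :
  (forall s : seq int, uniq s -> \sum_(k <- s) `|a k| <= M) ->
  cvg_bisum a /\ `|bisum a| <= M.
Proof.
move=> aM; pose p n := a (Posz n); pose q n := a (Negz n).
have nE (u : nat -> R) n : [normed series u] n = \sum_(0 <= i < n) `|u i| by [].
have pqM n : [normed series p] n + [normed series q] n <= M.
  pose s := [seq Posz i | i <- iota 0 n] ++ [seq Negz i | i <- iota 0 n].
  have us : uniq s.
    rewrite cat_uniq !map_inj_uniq ?iota_uniq; [|by move=> ? ? []..].
    rewrite andbT/=; apply/hasPn => _ /mapP[i _ ->]; apply/mapP => -[j _].
    by [].
  have := aM s us.
  by rewrite big_cat !big_map /= -[in iota 0 n](subn0 n).
have ge0 (u : nat -> R) n : 0 <= [normed series u] n.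
  by rewrite nE; apply: sumr_ge0.
have cvgu (u : nat -> R) : (forall n, [normed series u] n <= M) ->
    cvgn [normed series u].
  move=> uM; apply: nondecreasing_is_cvgn.
    by apply: nondecreasing_series => i _ _ /=.
  by exists M => _ [n _ <-].
have cp : cvgn [normed series p].
  by apply: cvgu => n; apply: le_trans (pqM n); rewrite lerDl.
have cq : cvgn [normed series q].
  by apply: cvgu => n; apply: le_trans (pqM n); rewrite lerDr.
split; first by split; exact: normed_cvg.
rewrite /bisum (le_trans (ler_normD _ _))//.
rewrite (le_trans (lerD (lim_series_norm cp) (lim_series_norm cq)))//.
rewrite -limD//; apply: limr_le; first exact: is_cvgD.
by apply: nearW => n; exact: pqM.
Qed.

Lemma cvg_bisumD (R : realType) (a b : int -> R) :
  cvg_bisum a -> cvg_bisum b ->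
  cvg_bisum (a \+ b) /\ bisum (a \+ b) = bisum a + bisum b.
Proof.
have sD (u v : nat -> R) : series (u \+ v) = series u \+ series v.
  by apply/funext => n; rewrite /= !seriesEnat/= big_split.
move=> [ap an] [bp bn]; rewrite /cvg_bisum /bisum !sD.
split; first by split; exact: is_cvgD.
by rewrite !limD// addrACA.
Qed.

Lemma cvg_bisumZr (R : realType) (a : int -> R) (c : R) : cvg_bisum a ->
  cvg_bisum (fun k => a k * c) /\ bisum (fun k => a k * c) = bisum a * c.
Proof.
have sM (u : nat -> R) : series (fun n => u n * c) = (fun n => series u n * c).
  by apply/funext => n; rewrite !seriesEnat/= mulr_suml.
move=> [ap an]; rewrite /cvg_bisum /bisum !sM.
split; first by split; exact: is_cvgMl.
by rewrite mulrDl; congr (_ + _); apply/cvg_lim => //; apply: cvgM => //;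
  exact: cvg_cst.
Qed.

(** * Moments *)

Lemma discrete_moment_ge0 (R : realType) (nu : R) (g : R -> R) :
  (0 <= discrete_moment nu g)%E.
Proof.
apply: le_trans (ereal_sup_ubound _); last by exists 0.
by apply: esum_ge0 => k _; rewrite lee_fin mulr_ge0 ?powR_ge0.
Qed.

Lemma continuous_moment_ge0 (R : realType) (nu : R) (g : R -> R) :
  (0 <= continuous_moment nu g)%E.
Proof. by apply: integral_ge0 => t _; rewrite lee_fin mulr_ge0 ?powR_ge0. Qed.

Lemma discrete_moment_sum (R : realType) (nu : R) (g : R -> R) (M : R) :
  (discrete_moment nu g <= M%:E)%E ->
  forall (u : R) (s : seq int), uniq s ->
    \sum_(k <- s) `|g (u - k%:~R)| * `|u - k%:~R| `^ nu <= M.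
Proof.
move=> gM u s us; rewrite -lee_fin; apply: le_trans gM.
apply: le_trans (ereal_sup_ubound _); last by exists u.
apply: esum_ge; exists [set` s]; first by split=> //; exact: finite_seq.
by rewrite -sumEFin -fsbig_seq.
Qed.

(** At most one integer lies at distance less than 1/2 from u. *)
Lemma sum_near0_le (R : realType) (e B u : R) (s : seq int) :
  e <= 2^-1 -> 0 <= B -> uniq s ->
  \sum_(k <- s) (if `|u - k%:~R| < e then B else 0) <= B.
Proof.
move=> e2 B0 us; have [/hasP[k0 k0s uk0]|/hasPn no] :=
  boolP (has (fun k : int => `|u - k%:~R| < e) s); last first.
  by rewrite big_seq big1// => k /no /negbTE ->.
rewrite (bigD1_seq k0)//= uk0 big1 ?addr0// => k kk0.
case: ifPn => // uk; case/eqP: kk0.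
have : `|(k0 - k)%:~R : R| < 1.
  rewrite intrB (_ : _ - _ = (u - k%:~R) - (u - k0%:~R)); last by ring.
  rewrite (le_lt_trans (ler_normB _ _))//; lra.
rewrite -intr_norm (ltr_int _ _ 1) => lt1.
by apply/eqP; rewrite eq_sym -subr_eq0 -normr_eq0 eq_le normr_ge0 -ltzD1 lt1.
Qed.

(** Near the origin g is bounded by some B, and elsewhere, say for |t| >= e,
    the weight satisfies |t| / e >= 1.  Hence |g t| is at most
    |g t| |t| / e, plus B when |t| < e; with e <= 1/2, at most one integer
    translate of a point satisfies the latter. *)
Lemma discrete_moment0_sum (R : realType) (g : R -> R) (M1 : R) :
  bounded_near g (nbhs (0 : R)) -> (discrete_moment 1 g <= M1%:E)%E ->
  exists2 M0, 0 <= M0 & forall (u : R) (s : seq int), uniq s ->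
    \sum_(k <- s) `|g (u - k%:~R)| <= M0.
Proof.
move=> [B0 [_ gB0]] gM1.
pose B := `|B0| + 1; have B_ge0 : 0 <= B by rewrite addr_ge0.
have B0B : B0 < B by rewrite ltr_pwDr// ler_norm.
have /nbhs_ballP[e0 /= e00 ge0] := gB0 B B0B.
pose e := Num.min e0 2^-1.
have e_gt0 : 0 < e by rewrite lt_min e00 invr_gt0 ltr0n.
have gB t : `|t| < e -> `|g t| <= B.
  rewrite lt_min => /andP[te _]; apply: ge0.
  by rewrite -ball_normE/= sub0r normrN.
have M1_ge0 : 0 <= M1.
  by have := discrete_moment_sum gM1 0 (s := [::]) isT; rewrite big_nil.
exists (M1 / e + B); first by rewrite addr_ge0 ?divr_ge0 ?(ltW e_gt0).
move=> u s us.
have far : \sum_(k <- s) `|g (u - k%:~R)| * `|u - k%:~R| / e <= M1 / e.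
  rewrite -mulr_suml ler_pM2r ?invr_gt0//.
  have := discrete_moment_sum gM1 u us.
  by under eq_bigr do rewrite powRr1//.
have e2 : e <= 2^-1 by rewrite ge_min lexx orbT.
apply: le_trans (lerD far (sum_near0_le u e2 B_ge0 us)).
rewrite -big_split/=; apply: ler_sum => k _.
case: ifPn => [/gB gle|].
  by rewrite (le_trans gle)// lerDr divr_ge0 ?mulr_ge0 ?(ltW e_gt0).
rewrite -leNgt addr0 => eu; rewrite -mulrA ler_peMr//.
by rewrite ler_pdivlMr// mul1r.
Qed.

(** * The approximation error *)

(** The weighted mean of f against w * psi (w u - k) is close to f x: since the
    weight has integral 1, the difference is the mean of f u - f x, which the
    Hoelder condition controls by a function of w u - k. *)
Lemma mean_error_le (R : realType) (psi f : R -> R) (alpha K w k x : R) :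
  0 < w -> 0 <= alpha -> alpha <= 1 ->
  L1 psi -> integralR psi = 1 -> L1 (fun t => `|t| * `|psi t|) -> CR f ->
  0 <= K -> (forall u v, `|f u - f v| <= K * `|u - v| `^ alpha) ->
  `|w * integralR (fun u => psi (w * u - k) * f u) - f x| <=
    K * w `^ (- alpha) * ((1 + `|w * x - k|) * integralR (fun t => `|psi t|)
                          + integralR (fun t => `|t| * `|psi t|)).
Proof.
move=> w0 a0 a1 ipsi psi1 mpsi fC K0 fK.
pose s := `|w * x - k|; pose c := K * w `^ (- alpha).
have c0 : 0 <= c by rewrite mulr_ge0 ?powR_ge0.
(* In the variable t = w u - k, the integrand of the mean of f u - f x is at
   most c * G t. *)
pose G t := (1 + s) * `|psi t| + `|t| * `|psi t|.
have i1 : L1 (fun t => (1 + s) * `|psi t|).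
  by apply: (integrableZl measurableT (1 + s) (L1_norm ipsi)).
have iG : L1 G by apply: (integrableD measurableT i1 mpsi).
have iGa := integrable_affine k w0 iG.
have ipsia : L1 (psi \o affine w k) := integrable_affine k w0 ipsi.
have ipf : L1 (fun u => psi (w * u - k) * f u) := L1_mul ipsia fC.
have ipx : L1 (fun u => f x * psi (w * u - k)).
  by apply: (integrableZl measurableT (f x) ipsia).
have EG : (1 + s) * integralR (fun t => `|psi t|)
    + integralR (fun t => `|t| * `|psi t|)
    = w * integralR (G \o affine w k).
  rewrite integral_affine// /G /integralR RintegralD// RintegralZl//.
  exact: L1_norm.
rewrite -/s -/c EG.
have Efx : f x = w * integralR (fun u => f x * psi (w * u - k)).
  rewrite /integralR RintegralZl// mulrCA -/(integralR (psi \o affine w k)).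
  by rewrite integral_affine// psi1 mulr1.
rewrite [in leLHS]Efx -mulrBr normrM gtr0_norm// mulrCA ler_pM2l//.
rewrite /integralR -RintegralB//.
rewrite -RintegralZl//.
have idiff : L1 (fun u => psi (w * u - k) * f u - f x * psi (w * u - k)).
  by apply: (integrableB measurableT ipf ipx).
apply: (le_trans (le_normr_Rintegral measurableT idiff)).
apply: le_Rintegral => //.
- exact: L1_norm idiff.
- by apply: (integrableZl measurableT c iGa).
move=> u _; rewrite /= /affine /G.
have -> : psi (w * u - k) * f u - f x * psi (w * u - k) =
  psi (w * u - k) * (f u - f x) by ring.
rewrite -mulrDl normrM mulrA [leRHS]mulrC ler_wpM2l//.
apply: (le_trans (fK u x)).
rewrite -mulrA ler_wpM2l//.
have -> : `|u - x| `^ alpha = w `^ (- alpha) * (w * `|u - x|) `^ alpha.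
  by rewrite powRM ?(ltW w0)// mulrA powRN mulVf ?mul1r// gt_eqF ?powR_gt0.
rewrite ler_wpM2l ?powR_ge0//.
have wux : 0 <= w * `|u - x| by rewrite mulr_ge0 ?(ltW w0).
rewrite (le_trans (powR_le_1D a0 a1 wux))// -addrA lerD2l.
rewrite -[X in X * _](gtr0_norm w0) -normrM.
have -> : w * (u - x) = (w * u - k) - (w * x - k) by ring.
by rewrite addrC ler_normB.
Qed.

(** As the translates of phi sum to 1, the error is the bilateral sum of the
    differences between the terms of the operator and phi (w x - k) * f x. *)
Lemma durrmeyer_error (R : realType) (phi psi f : R -> R) (w x D : R) :
  (forall u : R, cvg_bisum (fun k : int => phi (u - k%:~R)) /\
                 bisum (fun k : int => phi (u - k%:~R)) = 1) ->
  (forall s : seq int, uniq s -> \sum_(k <- s)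
     `|durrmeyer_term phi psi w f x k - phi (w * x - k%:~R) * f x| <= D) ->
  cvg_bisum (durrmeyer_term phi psi w f x) /\
  `|durrmeyer phi psi w f x - f x| <= D.
Proof.
move=> phi1 /bisum_le; set d := fun k : int => _ - _ => -[cd dD].
have [cphi phix1] := phi1 (w * x).
have [cfx bfx] := cvg_bisumZr (f x) cphi.
have [cD bD] := cvg_bisumD cd cfx.
have dE : durrmeyer_term phi psi w f x =
    d \+ (fun k : int => phi (w * x - k%:~R) * f x).
  by apply/funext => k; rewrite /d/= subrK.
by rewrite /durrmeyer dE bD bfx phix1 mul1r addrK.
Qed.

Unset Implicit Arguments.

Theorem corollary5p1 (R : realType) (phi psi : R -> R) (alpha : R) (f : R -> R)
    (kernels : kernel_pair phi psi)
    (moments : (discrete_moment 1 phi + continuous_moment 1 psi < +oo)%E)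
    (alpha_gt0 : 0 < alpha) (alpha_le1 : alpha <= 1)
    (f_Lip : Lip alpha f) :
  exists2 C : R, 0 < C &
    forall w : R, 0 < w ->
      durrmeyer_defined phi psi w f /\
      (supnorm (fun x : R => durrmeyer phi psi w f x - f x)%R
         <= (C * w `^ (- alpha))%:E)%E.
Proof.
have [[_ ipsi] phi0 phi1 psi1 _] := kernels.
have fC := f_Lip.1.
have [K K0 fK] := Lip_hoelder alpha_gt0 f_Lip.
have d0 := discrete_moment_ge0 1 phi; have c0 := continuous_moment_ge0 1 psi.
have dfin : discrete_moment 1 phi \is a fin_num.
  by rewrite ge0_fin_numE// (le_lt_trans _ moments)// leeDl.
have mpsi : L1 (fun t => `|t| * `|psi t|).
  by apply: L1_moment => //; rewrite (le_lt_trans _ moments)// leeDr.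
pose M1 := fine (discrete_moment 1 phi).
have phiM1 : (discrete_moment 1 phi <= M1%:E)%E by rewrite fineK.
have [M0 M0_ge0 phiM0] := discrete_moment0_sum phi0 phiM1.
pose A := integralR (fun t => `|psi t|).
pose B := integralR (fun t => `|t| * `|psi t|).
have A0 : 0 <= A by apply: Rintegral_ge0.
have B0 : 0 <= B by apply: Rintegral_ge0 => t _; rewrite mulr_ge0.
have M10 : 0 <= M1 by rewrite fine_ge0.
pose C0 := K * ((A + B) * M0 + A * M1).
have C00 : 0 <= C0 by rewrite !(mulr_ge0, addr_ge0).
(* C0 may vanish, whereas the constant has to be positive. *)
exists (C0 + 1) => [|w w0]; first by rewrite ltr_pwDr.
have err x (s : seq int) : uniq s -> \sum_(k <- s)
    `|durrmeyer_term phi psi w f x k - phi (w * x - k%:~R) * f x|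
    <= (C0 + 1) * w `^ (- alpha).
  move=> us; pose c := K * w `^ (- alpha).
  have cge0 : 0 <= c by rewrite mulr_ge0 ?powR_ge0.
  apply: (@le_trans _ _ (\sum_(k <- s)
      (c * (A + B) * `|phi (w * x - k%:~R)| +
       c * A * (`|phi (w * x - k%:~R)| * `|w * x - k%:~R| `^ 1)))).
    apply: ler_sum => k _.
    rewrite /durrmeyer_term -mulrBr normrM powRr1//.
    have e := mean_error_le k%:~R x w0 (ltW alpha_gt0) alpha_le1 ipsi psi1 mpsi
      fC K0 fK.
    rewrite (le_trans (ler_wpM2l (normr_ge0 _) e))// -/A -/B -/c.
    by rewrite le_eqVlt; apply/orP; left; apply/eqP; ring.
  rewrite big_split/= -!mulr_sumr.
  apply: (@le_trans _ _ (c * (A + B) * M0 + c * A * M1)).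
    apply: lerD; rewrite ler_wpM2l ?phiM0 ?(mulr_ge0, addr_ge0, powR_ge0)//.
    exact: discrete_moment_sum.
  rewrite mulrDl mul1r ler_wpDr ?powR_ge0//.
  by rewrite le_eqVlt; apply/orP; left; apply/eqP; rewrite /c /C0; ring.
have dur x := durrmeyer_error phi1 (err x).
split; first split.
- by move=> k; exact: L1_mul (integrable_affine k%:~R w0 ipsi) fC.
- by move=> x; case: (dur x).
- by apply: ge_ereal_sup => _ [x _ <-]; rewrite lee_fin; case: (dur x).
Qed.
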